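(* Let $T$ be a numerical semigroup, $I$ a non-empty set of non-negative integers, and $\emptyset\ne J\subseteq I$. Then $S_J^I(T)$ is a gap absorbing monoid if and only if $T$ is an ordinary numerical semigroup. In this case, $$\mathcal{M}(S_J^I(T))=\{\mathbf{m}=(m_i)_{i\in I}\in\mathbb{N}^{(I)}:|\mathbf{m}|_J=\min(T^* )\text{ and }m_i=0\text{ for all }i\in I\setminus J\}.$$
   Context: $\mathbb{N}$ is the set of non-negative integers. For a non-empty set $I\subseteq\mathbb{N}$, $\mathbb{N}^{(I)}$ is the additive monoid (componentwise addition) of all sequences $(n_i)_{i\in I}$ of non-negative integers with $n_i=0$ for all but finitely many $i$; $\mathbf{0}$ is the zero sequence and $\le$ is the componentwise partial order. A numerical semigroup is a submonoid $T$ of $(\mathbb{N},+)$ with $\mathbb{N}\setminus T$ finite; $T^*=T\setminus\{0\}$; $T$ is ordinary if $T=\{0\}\cup(m+\mathbb{N})$ for some positive integer $m$. For $\emptyset\ne J\subseteq I$ and $\mathbf{x}=(x_i)_{i\in I}\in\mathbb{N}^{(I)}$, put $|\mathbf{x}|_J=\sum_{j\in J}x_j$, and define the submonoid $S_J^I(T)=\{\mathbf{x}\in\mathbb{N}^{(I)}:|\mathbf{x}|_J\in T\setminus\{0\}\}\cup\{\mathbf{0}\}$ of $\mathbb{N}^{(I)}$. For a submonoid $S$ of $\mathbb{N}^{(I)}$: $S^*=S\setminus\{\mathbf{0}\}$; $\mathcal{H}(S)=\mathbb{N}^{(I)}\setminus S$; $\mathcal{A}(S)=S^*\setminus(S^*+S^*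 )$ is the set of atoms; $\mathcal{M}(S)$ is the set of $\le$-minimal elements of $S^*$. With $2X=X+X$, the submonoid $S$ is gap absorbing if $2\mathcal{H}(S)\subseteq\mathcal{H}(S)\cup\mathcal{A}(S)\cup 2\mathcal{A}(S)$ and $\mathcal{H}(S)+\mathcal{A}(S)\subseteq\mathcal{A}(S)\cup 2\mathcal{A}(S)$. *)

(* Defs.v *)
From HB Require Import structures.
From mathcomp Require Import all_boot all_order all_algebra finmap.
From mathcomp Require Import boolp classical_sets functions cardinality fsbigop.

Set Implicit Arguments.
Unset Strict Implicit.
Unset Printing Implicit Defensive.

Import GRing.Theory.

Local Open Scope classical_set_scope.
Local Open Scope ring_scope.

(** N^(K) for an arbitrary index type K.  For I : set nat, [finsuppnat I] is
    indexed by the subtype {i : nat | i \in I}, and [val : I -> nat] is the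
    inclusion. *)
Definition finsuppnat (K : choiceType) : Type := {fsfun K -> nat with 0%N}.

HB.instance Definition _ (K : choiceType) := Choice.on (finsuppnat K).

Section FinsuppnatMonoid.
Variable K : choiceType.
Implicit Types x y z : finsuppnat K.

Definition fsn_zero : finsuppnat K := [fsfun].

Definition fsn_add x y : finsuppnat K :=
  [fsfun k in (finsupp x `|` finsupp y)%fset => (x k + y k)%N].

Lemma fsn_zeroE k : fsn_zero k = 0%N.
Proof. by rewrite /fsn_zero fsfun0E. Qed.

Lemma fsn_addE x y k : fsn_add x y k = (x k + y k)%N.
Proof.
rewrite /fsn_add fsfunE in_fsetU; case: ifPn => //.
by rewrite negb_or => /andP[xk yk]; rewrite !fsfun_dflt.
Qed.

Lemma fsn_addA : associative fsn_add.
Proof. by move=> x y z; apply/fsfunP => k; rewrite !fsn_addE addnA. Qed.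

Lemma fsn_addC : commutative fsn_add.
Proof. by move=> x y; apply/fsfunP => k; rewrite !fsn_addE addnC. Qed.

Lemma fsn_add0 : left_id fsn_zero fsn_add.
Proof. by move=> x; apply/fsfunP => k; rewrite fsn_addE fsn_zeroE. Qed.

HB.instance Definition _ :=
  GRing.isNmodule.Build (finsuppnat K) fsn_addA fsn_addC fsn_add0.

Definition fsn_le x y : Prop := forall k, (x k <= y k)%N.

End FinsuppnatMonoid.

Section Submonoids.
Variable V : nmodType.
Implicit Types S A B : set V.

Definition submonoid S : Prop :=
  S 0 /\ (forall x y, S x -> S y -> S (x + y)).

Definition sumset A B : set V := [set x + y | x in A & y in B].

Definition nonzero S : set V := S `\ 0.

Definition gaps S : set V := ~` S.

Definition atoms S : set V :=
  nonzero S `\` sumset (nonzero S) (nonzero S).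

Definition gap_absorbing S : Prop :=
  [/\ submonoid S,
      sumset (gaps S) (gaps S)
        `<=` gaps S `|` atoms S `|` sumset (atoms S) (atoms S)
    & sumset (gaps S) (atoms S)
        `<=` atoms S `|` sumset (atoms S) (atoms S)].

End Submonoids.

Definition minimals (K : choiceType) (S : set (finsuppnat K)) :
    set (finsuppnat K) :=
  [set x | nonzero S x /\ forall y, nonzero S y -> fsn_le y x -> y = x].

Definition numerical_semigroup (T : set nat) : Prop :=
  submonoid T /\ finite_set (~` T).

Definition ordinary (T : set nat) : Prop :=
  exists2 m : nat, (0 < m)%N &
    T = [set 0%N] `|` [set (m + n)%N | n in [set: nat]].

(* Junk value 0 when A is empty. *)
Definition set_min (A : set nat) : nat :=
  xget 0%N [set m | A m /\ forall n, A n -> (m <= n)%N].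

(* |x|_J.  The sum has finite support, so it is the genuine sum even if J is
   infinite. *)
Definition norm_on (I J : set nat) (x : finsuppnat I) : nat :=
  \sum_(i \in [set i : I | J (val i)]) x i.
Arguments norm_on {I} J x.

(* S_J^I(T) *)
Definition SJI (I J T : set nat) : set (finsuppnat I) :=
  [set x | nonzero T (norm_on J x)] `|` [set 0].
Arguments SJI : clear implicits.

(* Main.v *)
Require Import Defs.
From mathcomp Require Import all_boot all_order all_algebra finmap.
From mathcomp Require Import boolp classical_sets functions cardinality fsbigop.
From mathcomp Require Import zify.

(** Write [m] for the least element of [T \ {0}].  If [S_J(T)] is gap absorbing
    and [j] is in [J], then [m e_j] is an atom, and for [n >= m] with [n - m]
    not in [T] the sequence [(n - m) e_j] is a gap; their sum lies in [S_J(T)],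
    so [n] is in [T].  Conversely, if [T = {0} U (m + N)], then the gaps are the
    nonzero [x] with [|x|_J < m] and the atoms those with [m <= |x|_J < 2m],
    because every [x] splits as [y + z] with [|y|_J] prescribed and [y]
    supported in [J]. *)

Local Open Scope classical_set_scope.
Local Open Scope ring_scope.

(** * The norm $|x|_J$ and the splitting of sequences *)

Section NormOn.
Context {I : set nat}.
Implicit Types (J : set nat) (x y z : finsuppnat I) (j : I).

(** Replaces the possibly infinite index set [J] by its trace on any finite [A] carrying the
    support, so that sums of several sequences can share one finite index set. *)
Lemma norm_on_finite J x (A : set I) : finite_set A ->
  (forall i, ~ A i -> x i = 0%N) ->
  norm_on J x = \sum_(i \in [set i : I | J (val i)] `&` A) x i.
Proof.
move=> finA xA; apply/esym/fsbig_widen; first by move=> i [].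
by move=> i [Ji NJAi]; apply: xA => Ai; apply: NJAi.
Qed.

Lemma norm_onD J x y : norm_on J (x + y) = (norm_on J x + norm_on J y)%N.
Proof.
pose A : set I := [set` finsupp x] `|` [set` finsupp y].
have finA : finite_set A by rewrite finite_setU; split; exact: finite_fset.
have xA i : ~ A i -> x i = 0%N.
  by move=> NAi; apply: fsfun_dflt; apply/negP => xi; apply: NAi; left.
have yA i : ~ A i -> y i = 0%N.
  by move=> NAi; apply: fsfun_dflt; apply/negP => yi; apply: NAi; right.
rewrite !(norm_on_finite _ _ A)//; last first.
  by move=> i NAi; rewrite fsn_addE xA ?yA.
rewrite -[RHS]fsbig_split; last exact: finite_setIr.
by apply: eq_fsbigr => i _; rewrite fsn_addE.
Qed.

Lemma norm_on_eq0 J x : (forall i : I, J (val i) -> x i = 0%N) ->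
  norm_on J x = 0%N.
Proof. exact: fsbig1. Qed.

Lemma norm_on0 J : norm_on J (0 : finsuppnat I) = 0%N.
Proof. by apply: norm_on_eq0 => i _; rewrite fsn_zeroE. Qed.

Definition fsn_single j (n : nat) : finsuppnat I :=
  [fsfun i in [fset j]%fset => n].

Lemma fsn_singleE j n i : fsn_single j n i = if i == j then n else 0%N.
Proof. by rewrite /fsn_single fsfunE in_fset1. Qed.

Lemma fsn_singleD j m n :
  fsn_single j (m + n)%N = fsn_single j m + fsn_single j n.
Proof.
by apply/fsfunP => i; rewrite fsn_addE !fsn_singleE; case: eqP.
Qed.

Lemma norm_on_single J j n : J (val j) -> norm_on J (fsn_single j n) = n.
Proof.
move=> Jj; rewrite (norm_on_finite _ _ [set j])//; last first.
  by move=> i /= ij; rewrite fsn_singleE; case: eqP.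
rewrite setIC setIidl ?fsbig_set1 ?fsn_singleE ?eqxx//.
by move=> i ->.
Qed.

Lemma fsn_leP x y : fsn_le x y -> exists z, y = x + z.
Proof.
move=> xy; exists [fsfun i in finsupp y => (y i - x i)%N].
apply/fsfunP => i; rewrite fsn_addE fsfunE.
case: ifPn => [_|yi]; first by rewrite subnKC.
(* Outside the support of [y], the bound [x i <= y i] forces [x i = 0]. *)
have /(_ i) := xy; rewrite (fsfun_dflt yi) leqn0 => /eqP -> //.
Qed.

Lemma fsn_leDr x y : fsn_le x (x + y).
Proof. by move=> i; rewrite fsn_addE leq_addr. Qed.

Lemma leq_norm_on J x j : J (val j) -> (x j <= norm_on J x)%N.
Proof.
move=> Jj; have /fsn_leP[z xz] : fsn_le (fsn_single j (x j)) x.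
  by move=> i; rewrite fsn_singleE; case: eqP => // ->.
by rewrite [in leqRHS]xz norm_onD norm_on_single// leq_addr.
Qed.

(** Induction on [k]: as long as $|z|_J > 0$, one unit at some [j] in [J] moves from [z] to [y]. The
    support clause serves the description of the minimal elements. *)
Lemma norm_on_split J x k : (k <= norm_on J x)%N ->
  exists y z, [/\ x = y + z, norm_on J y = k &
    forall i : I, ~ J (val i) -> y i = 0%N].
Proof.
elim: k => [_|k IHk kx].
  exists 0, x; split; rewrite ?GRing.add0r ?norm_on0// => i _.
  exact: fsn_zeroE.
have [y [z [xyz yk yJ]]] := IHk (ltnW kx).
have [j Jj zj] : exists2 j : I, J (val j) & (0 < z j)%N.
  apply: contrapT => Nz; move: kx; rewrite xyz norm_onD yk.
  rewrite [X in (_ + X)%N]norm_on_eq0 ?addn0 ?ltnn// => i Ji.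
  by apply/eqP; rewrite -leqn0 leqNgt; apply/negP => zi; apply: Nz; exists i.
have /fsn_leP[w zw] : fsn_le (fsn_single j 1) z.
  by move=> i; rewrite fsn_singleE; case: eqP => // ->.
exists (y + fsn_single j 1), w; split.
- by rewrite xyz zw GRing.addrA.
- by rewrite norm_onD norm_on_single// yk addn1.
- move=> i NJi; rewrite fsn_addE yJ// fsn_singleE.
  by case: eqP => // ij; case: NJi; rewrite ij.
Qed.

(** * Elements and gaps of $S_J(T)$ *)

Lemma SJIE J T x : SJI I J T x <-> nonzero T (norm_on J x) \/ x = 0.
Proof. by []. Qed.

Lemma nonzero_SJI J T x : nonzero (SJI I J T) x <-> nonzero T (norm_on J x).
Proof.
split=> [[[//|x0] /(_ x0)//]|Tx]; split; first by left.
by move=> x0; case: Tx => _; apply; rewrite x0 norm_on0.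
Qed.

Lemma gaps_SJI J T x : gaps (SJI I J T) x <->
  ~ nonzero T (norm_on J x) /\ x <> 0.
Proof. by split=> [/not_orP|[? ?]] // []. Qed.

Lemma submonoid_SJI J T : submonoid T -> submonoid (SJI I J T).
Proof.
move=> [T0 TD]; split=> [|x y]; first by right.
move=> [[Tx x0]|->] Sy; last by rewrite GRing.add0r.
case: Sy => [[Ty y0]|->]; last by rewrite GRing.addr0; left.
left; rewrite /= norm_onD; split; first exact: TD.
by move=> /eqP; rewrite addn_eq0 => /andP[/eqP/x0].
Qed.

(** Gap absorption is applied to the gap $n e_j$ and the atom $m e_j$. *)
Lemma gap_absorbing_SJI_add {J T : set nat} {j m n} : J (val j) ->
  nonzero T m -> (forall k, nonzero T k -> (m <= k)%N) ->
  gap_absorbing (SJI I J T) -> ~ T n -> T 0%N -> T (m + n)%N.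
Proof.
move=> Jj Tm mT [[_ SD] _ SHA] NTn T0.
have m0 : (0 < m)%N by case: Tm => _ /eqP; rewrite lt0n.
have Sm : nonzero (SJI I J T) (fsn_single j m).
  by apply/nonzero_SJI; rewrite norm_on_single.
have Am : atoms (SJI I J T) (fsn_single j m).
  (* A decomposition of $m e_j$ would have norm at least $2m > m$. *)
  split=> // -[y /nonzero_SJI/mT my [z /nonzero_SJI/mT mz]].
  by move=> /(congr1 (norm_on J)); rewrite norm_onD norm_on_single//; lia.
have Hn : gaps (SJI I J T) (fsn_single j n).
  apply/gaps_SJI; split; rewrite ?norm_on_single//; first by case.
  move=> /(congr1 (norm_on J)); rewrite norm_on_single// norm_on0 => n0.
  by apply: NTn; rewrite n0.
suff : SJI I J T (fsn_single j (m + n)).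
  move=> /SJIE[[]|]; rewrite ?norm_on_single// => /(congr1 (norm_on J)).
  by rewrite norm_on_single// norm_on0 => ->.
have /SHA : sumset (gaps (SJI I J T)) (atoms (SJI I J T))
    (fsn_single j (m + n)).
  exists (fsn_single j n) => //; exists (fsn_single j m) => //.
  by rewrite GRing.addrC -fsn_singleD.
(* Atoms lie in the monoid, and so do sums of two atoms. *)
case=> [[[]]//|[y [[Sy _] _] [z [[Sz _] _] <-]]]; exact: SD.
Qed.

End NormOn.

(** * Least elements, and gap absorbing implies ordinary *)

Lemma set_minP {A : set nat} : A !=set0 ->
  A (set_min A) /\ forall n, A n -> (set_min A <= n)%N.
Proof.
move=> [a Aa].
apply: (@xgetPex _ 0%N [set m | A m /\ forall n, A n -> (m <= n)%N]).
have exA : exists n, `[< A n >] by exists a; apply/asboolP.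
exists (ex_minn exA); case: ex_minnP => m /asboolP Am mA.
by split=> // n An; apply/mA/asboolP.
Qed.

(** Otherwise $\mathbb{N}$ would be the union of the finite complement of [T] and $\{0\}$. *)
Lemma numerical_semigroup_nonzero {T : set nat} :
  numerical_semigroup T -> nonzero T !=set0.
Proof.
move=> [_ finCT]; apply: contrapT => T0; apply: infinite_nat.
apply: (@sub_finite_set _ _ (~` T `|` [set 0%N])).
  move=> n _; have [Tn|] := pselect (T n); last by left.
  by right; apply: contrapT => n0; apply: T0; exists n.
by rewrite finite_setU; split.
Qed.

Lemma nonzero_ordinaryE (T : set nat) (m : nat) : (0 < m)%N ->
  T = [set 0%N] `|` [set (m + n)%N | n in [set: nat]] ->
  forall n, nonzero T n <-> (m <= n)%N.
Proof.
move=> m0 -> n; split=> [[[//|[k _ <-] _]]|mn]; first exact: leq_addr.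
split; first by right; exists (n - m)%N => //; rewrite subnKC.
by move=> n0; move: mn; rewrite n0 leqNgt m0.
Qed.

Lemma gap_absorbing_SJI_ordinary (T I J : set nat) :
  numerical_semigroup T -> J !=set0 -> J `<=` I ->
  gap_absorbing (SJI I J T) -> ordinary T.
Proof.
move=> hT [j Jj] JI gS; have [[T0 TD] _] := hT.
have [Tm mT] := set_minP (numerical_semigroup_nonzero hT).
set m := set_min _ in Tm mT *.
have m0 : (0 < m)%N by case: Tm => _ /eqP; rewrite lt0n.
exists m => //; apply/seteqP; split=> n.
  move=> Tn; have [->|/eqP n0] := eqVneq n 0%N; first by left.
  by right; exists (n - m)%N => //; rewrite subnKC// mT.
(* If [k] is in [T], closure under addition gives [m + k]; otherwise [k] gives a gap on the axis of
   [j]. *)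
move=> [->//|[k _ <-]]; have [Tk|NTk] := pselect (T k).
  by case: Tm => Tm _; exact: TD.
pose i : I := exist _ j (mem_set (JI _ Jj)).
by apply: (gap_absorbing_SJI_add (j := i)) gS NTk T0.
Qed.

(** * The ordinary case: gaps, atoms and minimal elements read off from the norm *)

Section Ordinary.
Context {I J T : set nat} {m : nat}.
Hypotheses (m0 : (0 < m)%N) (Tm : forall n, nonzero T n <-> (m <= n)%N).
Implicit Types x y z : finsuppnat I.

Lemma nonzero_SJI_ordinary x :
  nonzero (SJI I J T) x <-> (m <= norm_on J x)%N.
Proof. exact: iff_trans (nonzero_SJI _ _ _) (Tm _). Qed.

Lemma gaps_SJI_ordinary x : gaps (SJI I J T) x -> (norm_on J x < m)%N.
Proof. by move=> /gaps_SJI[+ _]; rewrite Tm => /negP; rewrite -ltnNge. Qed.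

(** From norm $2m$ on, a piece of norm [m] splits off and leaves at least [m]; conversely, two
    nonzero elements add up to norm at least $2m$. *)
Lemma atoms_SJI_ordinary x :
  atoms (SJI I J T) x <-> (m <= norm_on J x < m + m)%N.
Proof.
split=> [[/nonzero_SJI_ordinary mx Nx]|/andP[mx xmm]].
  rewrite mx ltnNge; apply/negP => mmx; apply: Nx.
  have [y [z [xyz ym _]]] := norm_on_split J x m mx.
  exists y; first by apply/nonzero_SJI_ordinary; rewrite ym.
  exists z => //; apply/nonzero_SJI_ordinary.
  by move: mmx; rewrite xyz norm_onD ym leq_add2l.
split; first exact/nonzero_SJI_ordinary.
move=> [y /nonzero_SJI_ordinary my [z /nonzero_SJI_ordinary mz xyz]].
by move: xmm; rewrite -xyz norm_onD; lia.
Qed.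

Lemma sumset_atoms_SJI_ordinary x : (m + m <= norm_on J x < m + m + m)%N ->
  sumset (atoms (SJI I J T)) (atoms (SJI I J T)) x.
Proof.
move=> /andP[mmx xmmm]; have mx : (m <= norm_on J x)%N by lia.
have [y [z [xyz ym _]]] := norm_on_split J x m mx.
move: mmx xmmm; rewrite xyz norm_onD ym => mmx xmmm.
by exists y; [|exists z => //]; apply/atoms_SJI_ordinary; lia.
Qed.

(** Two gaps sum to norm below $2m$; a gap plus an atom has norm in $[m, 3m)$. *)
Lemma gap_absorbing_SJI : submonoid T -> gap_absorbing (SJI I J T).
Proof.
move=> /submonoid_SJI subS; split=> // _ [x Hx [y Hy <-]].
  have xm := gaps_SJI_ordinary _ Hx; have ym := gaps_SJI_ordinary _ Hy.
  left; have [xym|mxy] := ltnP (norm_on J (x + y)) m; last first.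
    by right; apply/atoms_SJI_ordinary; move: mxy; rewrite norm_onD; lia.
  left; apply/gaps_SJI; split; first by rewrite Tm; apply/negP; rewrite -ltnNge.
  (* A sum of non-negative sequences vanishes only if both do, whereas the gap [x] is nonzero. *)
  move=> xy0; move: Hx => /gaps_SJI[_]; apply; apply/fsfunP => i.
  have := congr1 (fun z : finsuppnat I => z i) xy0.
  by rewrite fsn_addE !fsn_zeroE => /eqP; rewrite addn_eq0 => /andP[/eqP].
have xm := gaps_SJI_ordinary _ Hx.
move/atoms_SJI_ordinary: Hy => /andP[my ymm].
have [xymm|mmxy] := ltnP (norm_on J (x + y)) (m + m); [left|right].
  by apply/atoms_SJI_ordinary; move: xymm; rewrite norm_onD; lia.
by apply: sumset_atoms_SJI_ordinary; move: mmxy; rewrite norm_onD; lia.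
Qed.

(** A minimal [x] equals the piece of norm [m], supported in [J], that splits off from it.
    Conversely, for [y] below [x] the difference [z] vanishes on [J] by comparing norms, and off [J]
    because [x] does. *)
Lemma minimals_SJI_ordinary : minimals (SJI I J T) =
  [set x : finsuppnat I | norm_on J x = m /\
    forall i : I, (I `\` J) (val i) -> x i = 0%N].
Proof.
apply/seteqP; split=> x.
  move=> [/nonzero_SJI_ordinary mx xmin].
  have [y [z [xyz ym yJ]]] := norm_on_split J x m mx.
  have <- : y = x.
    apply: xmin; first by apply/nonzero_SJI_ordinary; rewrite ym.
    by rewrite xyz; exact: fsn_leDr.
  by split=> // i [_ /yJ].
move=> [xm xJ]; split; first by apply/nonzero_SJI_ordinary; rewrite xm.
move=> y /nonzero_SJI_ordinary my /fsn_leP[z xyz].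
have z0 : norm_on J z = 0%N by move: xm; rewrite xyz norm_onD; lia.
apply/fsfunP => i; rewrite xyz fsn_addE.
have [Ji|NJi] := pselect (J (val i)).
  by have := leq_norm_on J z i Ji; rewrite z0 leqn0 => /eqP ->; rewrite addn0.
have : x i = 0%N by apply: xJ; split=> //; exact: set_valP.
by rewrite xyz fsn_addE; lia.
Qed.

End Ordinary.

Theorem proposition7p6 (T I J : set nat)
    (hT : numerical_semigroup T)
    (hI : I !=set0) (hJ : J !=set0) (hJI : J `<=` I) :
  (gap_absorbing (SJI I J T) <-> ordinary T) /\
  (ordinary T ->
    minimals (SJI I J T) =
    [set m : finsuppnat I |
      norm_on J m = set_min (nonzero T) /\
      forall i : I, (I `\` J) (val i) -> m i = 0%N]).
Proof.
split; first split.
- exact: gap_absorbing_SJI_ordinary.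
- move=> [m m0 /nonzero_ordinaryE-/(_ m0) Tm].
  by apply: (gap_absorbing_SJI m0 Tm); case: hT.
- move=> [m m0 /nonzero_ordinaryE-/(_ m0) Tm].
  have [/Tm mle lem] := set_minP (numerical_semigroup_nonzero hT).
  have -> : set_min (nonzero T) = m.
    by apply/eqP; rewrite eqn_leq mle lem//; exact/Tm.
  exact: minimals_SJI_ordinary.
Qed.
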